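(* Let $(X,f)$ be a dynamical system. Then, for every $k\in\mathbb{N}$ and $x\in X$, $$\overline{h}_{\mathrm{cor}}(f^k,x)=k\cdot\overline{h}_{\mathrm{cor}}(f,x),\qquad \underline{h}_{\mathrm{cor}}(f^k,x)=k\cdot\underline{h}_{\mathrm{cor}}(f,x).$$
   Context: $\mathbb{N}=\{1,2,\dots\}$. A dynamical system is a pair $(X,f)$ where $X=(X,\varrho)$ is a compact metric space and $f:X\to X$ is continuous; $f^k$ is the $k$-fold iterate (regarded as a map of the same metric space $X$). For $m\in\mathbb{N}$, Bowen's metric is $\varrho^f_m(y,z)=\max_{0\le i<m}\varrho(f^i(y),f^i(z))$. For $x\in X$, $m,n\in\mathbb{N}$, $\varepsilon>0$ the correlation sum is $$C^f_m(x,n,\varepsilon)=\frac1{n^2}\,\mathrm{card}\{(i,j):0\le i,j<n,\ \varrho^f_m(f^i(x),f^j(x))\le\varepsilon\}.$$ Put $\overline{c}^f_m(x,\varepsilon)=\limsup_{n\to\infty}C^f_m(x,n,\varepsilon)$ and $\underline{c}^f_m(x,\varepsilon)=\liminf_{n\to\infty}C^f_m(x,n,\varepsilon)$. The upper and lower local correlation entropies of $f$ at $x$ are $$\overline{h}_{\mathrm{cor}}(f,x)=\lim_{\varepsilon\to0}\limsup_{m\to\infty}\left(-\frac1m\right)\log\underline{c}^f_m(x,\varepsilon),\qquad \underline{h}_{\mathrm{cor}}(f,x)=\lim_{\varepsilon\to0}\liminf_{m\to\infty}\left(-\frac1m\right)\log\overline{c}^f_m(x,\varepsilon).$$ For $f^k$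 the same definitions are used with $f$ replaced by $f^k$. *)

(* Defs.v *)
From mathcomp Require Import all_boot all_order all_algebra.
From mathcomp Require Import all_classical all_reals all_analysis.
Set Implicit Arguments.
Unset Strict Implicit.
Unset Printing Implicit Defensive.
Import Order.TTheory GRing.Theory Num.Theory.
Import numFieldNormedType.Exports.

Local Open Scope classical_set_scope.
Local Open Scope ring_scope.

Section CorrelationEntropy.
Context {R : realType} {X : metricType R}.
Implicit Types (f : X -> X) (x y z : X) (m n : nat) (e : R).

(* Distances are nonnegative, so 0 is neutral for this maximum when 0 < m. *)
Definition bowen_dist f m y z : R :=
  \big[Num.max/0]_(i < m) mdist (iter i f y) (iter i f z).

Definition corr_sum f x m n e : R :=
  #|[pred ij : 'I_n * 'I_n |
      bowen_dist f m (iter ij.1 f x) (iter ij.2 f x) <= e]|%:R / n%:R ^+ 2.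

(* The value of [corr_sum] at n = 0 is irrelevant to the two limits below,
   and so are the values at m = 0 in [ucor_entropy] and [lcor_entropy]. *)
Definition ucorr f x m e : \bar R :=
  limn_esup (fun n => (corr_sum f x m n e)%:E).

Definition lcorr f x m e : \bar R :=
  limn_einf (fun n => (corr_sum f x m n e)%:E).

Definition ucor_rate f x e : \bar R :=
  limn_esup (fun m => (- m%:R^-1)%:E * lne (lcorr f x m e))%E.

Definition lcor_rate f x e : \bar R :=
  limn_einf (fun m => (- m%:R^-1)%:E * lne (ucorr f x m e))%E.

Let le_limn_esup (u v : (\bar R)^nat) :
  (forall n, u n <= v n)%E -> (limn_esup u <= limn_esup v)%E.
Proof.
move=> uv; rewrite !limn_esup_lim; apply: lee_lim; [exact: is_cvg_esups..|].
apply: nearW => n; apply: ge_ereal_sup => _ [i /= ni <-].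
by apply: le_trans (uv i) _; apply: ereal_sup_ubound; exists i.
Qed.

Let le_limn_einf (u v : (\bar R)^nat) :
  (forall n, u n <= v n)%E -> (limn_einf u <= limn_einf v)%E.
Proof. by move=> uv; rewrite leeN2; apply: le_limn_esup => n; rewrite /= leeN2. Qed.

Let lne_homo : {homo @lne R : a b / (a <= b)%E}.
Proof.
move=> a b ab; have [a0|a0] := leP a 0%E; first by rewrite le0_lneNy ?leNye.
by rewrite lee_lne// in_itv/= leey andbT ?(le_trans (ltW a0))// ltW.
Qed.

Let le_corr_sum f x m n : {homo corr_sum f x m n : e e' / e <= e'}.
Proof.
move=> e e' ee'; rewrite ler_wpM2r ?invr_ge0 ?exprn_ge0// ler_nat.
by apply: subset_leq_card; apply/fintype.subsetP => ij; rewrite !inE => /le_trans ->.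
Qed.

Let le_rate m (a b : \bar R) : (a <= b)%E ->
  ((- m%:R^-1)%:E * lne b <= (- m%:R^-1)%:E * lne a)%E.
Proof.
by move=> ab; rewrite EFinN !mulNe leeN2 lee_wpmul2l ?lee_fin ?invr_ge0// lne_homo.
Qed.

Lemma is_cvg_ucor_rate f x : cvg (ucor_rate f x e @[e --> 0^'+]).
Proof.
apply: nonincreasing_at_right_is_cvge; apply: nearW => b e e' _ _ ee'.
apply: le_limn_esup => m; apply: le_rate; apply: le_limn_einf => n.
by rewrite lee_fin le_corr_sum.
Qed.

Lemma is_cvg_lcor_rate f x : cvg (lcor_rate f x e @[e --> 0^'+]).
Proof.
apply: nonincreasing_at_right_is_cvge; apply: nearW => b e e' _ _ ee'.
apply: le_limn_einf => m; apply: le_rate; apply: le_limn_esup => n.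
by rewrite lee_fin le_corr_sum.
Qed.

(* The upper entropy is built from the lower correlation integral [lcorr], and
   conversely. The limits exist in [\bar R], see [is_cvg_ucor_rate] and
   [is_cvg_lcor_rate]. *)
Definition ucor_entropy f x : \bar R := lim (ucor_rate f x e @[e --> 0^'+]).

Definition lcor_entropy f x : \bar R := lim (lcor_rate f x e @[e --> 0^'+]).

End CorrelationEntropy.

(* Main.v *)
(* Write g = f^k. Uniform continuity of f, ..., f^(k-1) compares g-orbits of
   length m with f-orbits of length km, so up to constant factors a correlation
   sum of g is at most a correlation sum of f. Conversely, a correlation sum of f
   also counts pairs of times in different residue classes modulo k. In any
   finite metric set coloured with k colours, the number of delta-close pairs is
   at most 2k times the number of 2 delta-close pairs of equal colour, with no
   dimension-dependent constant; equal residues are then shifted to multiples of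
   k by a further iterate of f. Constant factors disappear in the exponential
   decay rate in m, and passing from f-orbits to g-orbits rescales m by k. *)
Require Import Defs.
From mathcomp Require Import all_boot all_order all_algebra.
From mathcomp Require Import all_classical all_reals all_analysis.
From mathcomp Require Import zify lra.
Set Implicit Arguments.
Unset Strict Implicit.
Unset Printing Implicit Defensive.
Import Order.TTheory GRing.Theory Num.Theory.
Import numFieldNormedType.Exports.

(** * Close pairs in a finite coloured set *)

Lemma leq_card_in (T T' : finType) (A : {pred T}) (B : {pred T'}) (h : T -> T') :
  {in A &, injective h} -> {in A, forall x, h x \in B} -> #|A| <= #|B|.
Proof.
move=> hinj hAB; rewrite -(card_in_image hinj); apply: subset_leq_card.
by apply/fintype.subsetP => _ /fintype.imageP[x xA ->]; exact: hAB.
Qed.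

Lemma card_rel (I : finType) (r : rel I) :
  #|[pred p : I * I | r p.1 p.2]| = \sum_j #|[pred i | r i j]|.
Proof.
rewrite -sum1_card (eq_bigr (fun j => \sum_(i | r i j) 1)); last first.
  by move=> j _; rewrite sum1_card.
rewrite (exchange_big_dep predT)//= pair_big_dep/=.
by apply: eq_bigl => -[].
Qed.

(* Orient each near pair so that the number of neighbours of [i] coloured like [j]
   is at least the number of neighbours of [j] coloured like [i]. For fixed [j]
   and colour of [i], the number of such [i] is then at most the number of points
   coloured like [j] that share a neighbour with [j]. *)
Lemma leq_card_near_same_color (I : finType) (k : nat) (c : I -> 'I_k)
    (near far : rel I) :
  symmetric near -> (forall i j j', near i j -> near i j' -> far j j') ->
  #|[pred p : I * I | near p.1 p.2]| <=
  2 * k * #|[pred p : I * I | far p.1 p.2 && (c p.1 == c p.2)]|.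
Proof.
move=> nearC nearfar.
pose deg i s := #|[pred j | near i j && (c j == s)]|.
pose r := [rel i j | near i j && (deg j (c i) <= deg i (c j))].
have rE : #|[pred p : I * I | near p.1 p.2]| <= 2 * #|[pred p : I * I | r p.1 p.2]|.
  rewrite mul2n -addnn; set A := [pred p | r _ _].
  have swapA : #|[pred p : I * I | r p.2 p.1]| <= #|A|.
    by apply: (@leq_card_in _ _ _ _ (fun p => (p.2, p.1))) => [[? ?] [? ?] _ _ [-> ->]|].
  apply: leq_trans (leq_add (leqnn _) swapA).
  rewrite -cardUI -[leqLHS]addn0 leq_add// subset_leq_card//.
  apply/fintype.subsetP => -[i j]; rewrite !inE/= (nearC j i) -andb_orr => ->/=.
  exact: leq_total.
apply: leq_trans rE _; rewrite -mulnA leq_mul2l/=.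
rewrite (card_rel r) (card_rel (fun i j => far i j && (c i == c j))).
rewrite big_distrr leq_sum//= => j _.
rewrite -sum1_card (partition_big c xpredT)//=.
rewrite -[X in X * _]card_ord -sum_nat_const leq_sum// => s _.
rewrite sum1_card.
(* A single [i] of colour [s] bounds the whole class: all its members are counted by [deg j s], and
   the orientation at this [i] passes to the points coloured like [j] around [i]. *)
have [i|r0] := pickP [pred i | r i j && (c i == s)]; last first.
  by rewrite eq_card0// => i; have := r0 i.
rewrite /= -andbA => /and3P[ij dij /eqP ci].
apply: leq_trans (_ : deg j s <= _).
  apply: subset_leq_card; apply/fintype.subsetP => i'; rewrite !inE/=.
  by case/andP=> /andP[]; rewrite nearC => -> _ ->.
rewrite -ci; apply: leq_trans dij _; apply: subset_leq_card.
apply/fintype.subsetP => j'; rewrite !inE/= => /andP[ij' ->].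
by rewrite (nearfar _ _ _ ij' ij).
Qed.

Local Open Scope classical_set_scope.
Local Open Scope ring_scope.

(** * Comparison of pair counts for [f] and [iter k f] *)

Section CorrelationCount.
Context {R : realType} {X : metricType R}.
Implicit Types (f : X -> X) (x y z : X) (m n : nat) (d e : R).

Lemma bowen_dist_leP f m y z e : 0 <= e ->
  reflect (forall i, (i < m)%N -> mdist (iter i f y) (iter i f z) <= e)
          (bowen_dist f m y z <= e).
Proof.
move=> e0; apply: (iffP (bigmax_leP _ _ _ _)) => [[_ h] i im|h].
  exact: (h (Ordinal im)).
by split => // i _; exact: h.
Qed.

Lemma bowen_distC f m y z : bowen_dist f m y z = bowen_dist f m z y.
Proof. by apply: eq_bigr => i _; rewrite metric_sym. Qed.

Lemma bowen_dist_trans f m y z w d e : 0 <= d -> d + d <= e ->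
  bowen_dist f m y z <= d -> bowen_dist f m y w <= d -> bowen_dist f m z w <= e.
Proof.
move=> d0 de /(bowen_dist_leP _ _ _ _ d0) yz /(bowen_dist_leP _ _ _ _ d0) yw.
apply/bowen_dist_leP => [|i im]; first exact: le_trans (addr_ge0 d0 d0) de.
apply: le_trans (metric_triangle _ (iter i f y) _) (le_trans _ de).
by rewrite lerD ?yw// metric_sym yz.
Qed.

Definition corr_card f x m n e : nat :=
  #|[pred ij : 'I_n * 'I_n |
      bowen_dist f m (iter ij.1 f x) (iter ij.2 f x) <= e]|.

(** Time [a] of [iter k f] is time [a * k] of [f]. A step [i < M] of [f] splits into [i %/ k < m]
    steps of [iter k f], where [d]-closeness is known, and fewer than [k] steps of [f], over which
    closeness degrades to [e]. *)
Lemma leq_corr_card_iterl f x k m M n N d e : (0 < k)%N -> 0 <= d -> 0 <= e ->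
  (forall y z, mdist y z <= d -> bowen_dist f k y z <= e) ->
  (M <= m * k)%N -> (n * k <= N)%N ->
  (corr_card (iter k f) x m n d <= corr_card f x M N e)%N.
Proof.
move=> k0 d0 e0 de Mmk nkN.
have akN (a : 'I_n) : (a * k < N)%N.
  by apply: leq_trans nkN; rewrite ltn_pmul2r.
apply: (@leq_card_in _ _ _ _ (fun p => (Ordinal (akN p.1), Ordinal (akN p.2)))).
  move=> [a b] [a' b'] _ _ [/eqP + /eqP]; rewrite !eqn_pmul2r//.
  by move=> /eqP/val_inj-> /eqP/val_inj->.
move=> [a b]; rewrite !inE/= => /(bowen_dist_leP _ _ _ _ d0) ab.
apply/bowen_dist_leP => // i iM.
rewrite (divn_eq i k) addnC !iterD !iterM.
have ikm : (i %/ k < m)%N by rewrite ltn_divLR// (leq_trans iM).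
have /(bowen_dist_leP _ _ _ _ e0) := de _ _ (ab _ ikm).
by apply; rewrite ltn_mod.
Qed.

(* A pair of times in the same residue class modulo [k] is pushed by fewer than
   [k] further steps of [f] to a pair of multiples of [k]; this costs one step
   of [iter k f] in the length of the orbits, and in their starting points. *)
Lemma leq_corr_card_iterr f x k m M n N d e : (0 < k)%N -> 0 <= d ->
  d + d <= e -> (m.+1 * k <= M)%N -> (N + k <= n * k)%N ->
  (corr_card f x M N d <= 2 * k * (k * corr_card (iter k f) x m n e))%N.
Proof.
move=> k0 d0 de mkM Nnk.
have e0 : 0 <= e := le_trans (addr_ge0 d0 d0) de.
pose c (i : 'I_N) := Ordinal (ltn_pmod i k0).
pose near_ e' := [rel i j : 'I_N | bowen_dist f M (iter i f x) (iter j f x) <= e'].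
apply: (leq_trans (@leq_card_near_same_color _ k c (near_ d) (near_ e) _ _)).
- by move=> i j; rewrite /= bowen_distC.
- by move=> i j j'; exact: bowen_dist_trans.
rewrite leq_mul2l; apply/orP; right.
have shift (i : 'I_N) : ((i %/ k).+1 < n)%N.
  by rewrite -(ltn_pmul2r k0) mulSn; have := ltn_ord i; have := leq_trunc_div i k; lia.
rewrite -[X in (X * _)%N]card_ord -cardX.
(* The two quotients determine the pair only up to its common residue, which is therefore recorded
   as well; this is the second factor [k]. *)
apply: (@leq_card_in _ _ _ _
  (fun p => (c p.1, (Ordinal (shift p.1), Ordinal (shift p.2))))).
  move=> [i j] [i' j']; rewrite !inE/= => /andP[_ /eqP[cij]] /andP[_ /eqP[cij']].
  move=> [ci di dj]; congr pair; apply: val_inj => /=.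
    by rewrite (divn_eq i k) (divn_eq i' k) di ci.
  by rewrite (divn_eq j k) (divn_eq j' k) dj -cij -cij' ci.
move=> [i j]; rewrite !inE/= => /andP[/(bowen_dist_leP _ _ _ _ e0) ij /eqP[cij]].
apply/bowen_dist_leP => // q qm.
(* The push to the next multiple takes [k - l %% k] steps, a number in [[1, k]] that agrees for [i]
   and [j] since their residues do. *)
have E (l : 'I_N) : iter q (iter k f) (iter (l %/ k).+1 (iter k f) x) =
    iter (q * k + (k - l %% k)) f (iter l f x).
  rewrite -iterD -iterM -iterD; congr (iter _ f x).
  by have := divn_eq l k; have := ltn_pmod l k0; nia.
rewrite -/(iter (i %/ k).+1 (iter k f) x) -/(iter (j %/ k).+1 (iter k f) x).
rewrite !E -cij ij//; apply: leq_trans mkM; rewrite mulSn.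
have : (q.+1 * k <= m * k)%N by rewrite leq_mul2r qm orbT.
by have := ltn_pmod i k0; rewrite mulSn; lia.
Qed.

End CorrelationCount.

(** * Upper and lower limits under reindexing; exponential decay rates *)

Section LimSupInf.
Context {R : realType}.
Implicit Types (u v A B : (\bar R)^nat) (z : \bar R) (r t K : R) (phi : nat -> nat).

Lemma lte_dense_EFin (x y : \bar R) : (x < y)%E ->
  exists2 r, (x < r%:E)%E & (r%:E < y)%E.
Proof.
case: x y => [x| |] [y| |]//.
- rewrite lte_fin => xy; exists ((x + y) / 2); rewrite lte_fin; lra.
- by exists (x + 1); rewrite ?ltry// lte_fin; lra.
- by exists (y - 1); rewrite ?ltNyr// lte_fin; lra.
- by exists 0; rewrite ?ltry ?ltNyr.
Qed.

Lemma limn_esup_le u z : (\forall n \near \oo, (u n <= z)%E) ->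
  (limn_esup u <= z)%E.
Proof.
move=> uz; apply: (@le_trans _ _ (ereal_sup [set u n | n in [set n | u n <= z]%E])).
  by apply: ereal_inf_lbound; exists [set n | u n <= z]%E.
by apply: ge_ereal_sup => _ [n /= ? <-].
Qed.

Lemma limn_esup_lt_near u z : (limn_esup u < z)%E ->
  \forall n \near \oo, (u n < z)%E.
Proof.
move=> /ereal_inf_lt[_ [V Voo <-] Vz]; apply: filterS Voo => n Vn.
by apply: le_lt_trans Vz; apply: ereal_sup_ubound; exists n.
Qed.

Lemma limn_einf_ge u z : (\forall n \near \oo, (z <= u n)%E) ->
  (z <= limn_einf u)%E.
Proof.
move=> zu; rewrite leeNr; apply: limn_esup_le.
by apply: filterS zu => n /=; rewrite leeN2.
Qed.

Lemma limn_einf_gt_near u z : (z < limn_einf u)%E ->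
  \forall n \near \oo, (z < u n)%E.
Proof.
rewrite lteNr => /limn_esup_lt_near; apply: filterS => n /=.
by rewrite lteN2.
Qed.

(** Testing against reals avoids case distinctions on infinite limits, and the gap between [r] and
    [r'] leaves room to absorb constant factors and bounded errors. *)
Lemma limn_esup_leM t u v : 0 < t ->
  (forall r r', r < r' -> (limn_esup v < r%:E)%E ->
     \forall n \near \oo, (u n <= (t * r')%:E)%E) ->
  (limn_esup u <= t%:E * limn_esup v)%E.
Proof.
move=> t0 h; rewrite leNgt; apply/negP => /lte_dense_EFin[z].
rewrite -lte_pdivlMl// -EFinM => /lte_dense_EFin[r vr]; rewrite lte_fin => rz.
apply/negP; rewrite -leNgt; apply: limn_esup_le.
by apply: filterS (h _ _ rz vr) => n; rewrite mulrA divff ?mul1r// gt_eqF.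
Qed.

Lemma limn_einf_geM t u v : 0 < t ->
  (forall r r', r' < r -> (r%:E < limn_einf v)%E ->
     \forall n \near \oo, ((t * r')%:E <= u n)%E) ->
  (t%:E * limn_einf v <= limn_einf u)%E.
Proof.
move=> t0 h; rewrite leNgt; apply/negP => /lte_dense_EFin[z uz].
rewrite -lte_pdivrMl// -EFinM => /lte_dense_EFin[r]; rewrite lte_fin => zr rv.
move: uz; apply/negP; rewrite -leNgt; apply: limn_einf_ge.
by apply: filterS (h _ _ zr rv) => n; rewrite mulrA divff ?mul1r// gt_eqF.
Qed.

Lemma limn_esup_le_comp u v phi K : 0 < K -> phi @ \oo --> \oo ->
  (\forall n \near \oo, (u n <= K%:E * v (phi n))%E) ->
  (limn_esup u <= K%:E * limn_esup v)%E.
Proof.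
move=> K0 phioo uv; apply: limn_esup_leM => // r r' rr' /limn_esup_lt_near vr.
apply: filterS2 uv (phioo _ vr) => n un /= vn; apply: le_trans un _.
by rewrite EFinM lee_pmul2l// (le_trans (ltW vn))// lee_fin ltW.
Qed.

(** Reindexing along [phi] can only raise a lower limit, so [phi] acts on the smaller sequence,
    whereas for upper limits it acts on the larger one. *)
Lemma limn_einf_le_comp u v phi K : 0 < K -> phi @ \oo --> \oo ->
  (\forall n \near \oo, (u (phi n) <= K%:E * v n)%E) ->
  (limn_einf u <= K%:E * limn_einf v)%E.
Proof.
move=> K0 phioo uv; rewrite -lee_pdivrMl//.
apply: limn_einf_geM => [|r r' rr' /limn_einf_gt_near ur]; first by rewrite invr_gt0.
apply: filterS2 uv (phioo _ ur) => n vn /= un.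
rewrite EFinM lee_pdivrMl//; apply: le_trans vn; apply: le_trans (ltW un).
by rewrite lee_fin ltW.
Qed.

Lemma cvg_near_linear phi t C : 0 < t ->
  (forall m, `|(phi m)%:R - t * m%:R| <= C) -> phi @ \oo --> \oo.
Proof.
move=> t0 phit P [N _ NP].
have := nbhs_infty_ger ((N%:R + C) / t); apply: filterS => m /=.
rewrite ler_pdivrMr// => Nm; apply: NP => /=; rewrite -(ler_nat R).
by have := phit m; rewrite ler_norml => /andP[]; lra.
Qed.

(** This removes the logarithm, also at the extremes: the rate is [+oo] for [a <= 0], where both
    sides fail, and [-oo] for [a = +oo], where both hold. *)
Lemma decay_rate_le m (a : \bar R) r : (0 < m)%N ->
  ((- m%:R^-1)%:E * lne a <= r%:E)%E = ((expR (- (r * m%:R)))%:E <= a)%E.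
Proof.
move=> m0; have m0R : 0 < m%:R^-1 :> R by rewrite invr_gt0 ltr0n.
have [a0|a0] := leP a 0%E.
  rewrite le0_lneNy// EFinN mulNe gt0_muleNy ?lte_fin//= leye_eq/=.
  by apply/esym/negbTE; rewrite -ltNge (le_lt_trans a0)// lte_fin expR_gt0.
case: a a0 => [a| |]//; last first.
  by rewrite /= EFinN mulNe gt0_muley ?lte_fin// leNye leey.
rewrite lte_fin => a0; rewrite lne_EFin// -EFinM !lee_fin mulNr.
by rewrite lerNl mulrC ler_pdivlMr ?ltr0n// mulNr -ler_expR lnK.
Qed.

Lemma decay_rate_ge m (a : \bar R) r : (0 < m)%N ->
  (r%:E <= (- m%:R^-1)%:E * lne a)%E = (a <= (expR (- (r * m%:R)))%:E)%E.
Proof.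
move=> m0; have m0R : 0 < m%:R^-1 :> R by rewrite invr_gt0 ltr0n.
have [a0|a0] := leP a 0%E.
  rewrite le0_lneNy// EFinN mulNe gt0_muleNy ?lte_fin//= leey.
  by rewrite (le_trans a0)// lee_fin expR_ge0.
case: a a0 => [a| |]//; last first.
  by rewrite /= EFinN mulNe gt0_muley ?lte_fin// leeNy_eq leye_eq.
rewrite lte_fin => a0; rewrite lne_EFin// -EFinM !lee_fin mulNr.
by rewrite lerNr mulrC ler_pdivrMr ?ltr0n// mulNr -ler_expR lnK.
Qed.

(** An eventual bound on the rate of [B] is pulled back along [phi]. The factor [K] and the
    deviation of [phi] from slope [t] change the exponent by a bounded amount, negligible against
    [m]. *)
Lemma decay_rate_le_linear A B phi t C K : 0 < t -> 0 < K ->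
  (forall m, `|(phi m)%:R - t * m%:R| <= C) ->
  (\forall m \near \oo, (B (phi m) <= K%:E * A m)%E) ->
  (limn_esup (fun m => (- m%:R^-1)%:E * lne (A m)) <=
   t%:E * limn_esup (fun m => (- m%:R^-1)%:E * lne (B m)))%E.
Proof.
move=> t0 K0 phit BA; apply: limn_esup_leM => // r r' rr' /limn_esup_lt_near.
have phioo := cvg_near_linear t0 phit; move/phioo => Br.
have phi_gt0 := phioo _ (nbhs_infty_gt 0).
near=> m.
have m0 : (0 < m)%N by near: m; exact: nbhs_infty_gt.
have pm0 : (0 < phi m)%N by near: m.
have BAm : (B (phi m) <= K%:E * A m)%E by near: m.
have Brm : ((- (phi m)%:R^-1)%:E * lne (B (phi m)) < r%:E)%E by near: m.
rewrite decay_rate_le// -(@lee_pmul2l _ K%:E)//.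
apply: le_trans BAm; move/ltW: Brm; rewrite decay_rate_le//; apply: le_trans.
rewrite -EFinM lee_fin -{1}(lnK K0) -expRD ler_expR.
(* The exponents compare as soon as [ln K + r * (phi m - t * m) <= t * (r' - r) * m]. *)
have : (`|r| * C + ln K) / (t * (r' - r)) <= m%:R by near: m; exact: nbhs_infty_ger.
rewrite ler_pdivrMr ?mulr_gt0 ?subr_gt0//.
have : r * ((phi m)%:R - t * m%:R) <= `|r| * C.
  by apply: le_trans (ler_norm _) _; rewrite normrM ler_wpM2l.
nra.
Unshelve. all: by end_near. Qed.

Lemma decay_rate_ge_linear A B phi t C K : 0 < t -> 0 < K ->
  (forall m, `|(phi m)%:R - t * m%:R| <= C) ->
  (\forall m \near \oo, (B m <= K%:E * A (phi m))%E) ->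
  (t%:E * limn_einf (fun m => (- m%:R^-1)%:E * lne (A m)) <=
   limn_einf (fun m => (- m%:R^-1)%:E * lne (B m)))%E.
Proof.
move=> t0 K0 phit BA; apply: limn_einf_geM => // r r' rr' /limn_einf_gt_near.
have phioo := cvg_near_linear t0 phit; move/phioo => Ar.
have phi_gt0 := phioo _ (nbhs_infty_gt 0).
near=> m.
have m0 : (0 < m)%N by near: m; exact: nbhs_infty_gt.
have pm0 : (0 < phi m)%N by near: m.
have BAm : (B m <= K%:E * A (phi m))%E by near: m.
have Arm : (r%:E < (- (phi m)%:R^-1)%:E * lne (A (phi m)))%E by near: m.
rewrite decay_rate_ge//; apply: le_trans BAm _.
move/ltW: Arm; rewrite decay_rate_ge// -(@lee_pmul2l _ K%:E)//; move/le_trans; apply.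
rewrite -EFinM lee_fin -{1}(lnK K0) -expRD ler_expR.
have : (`|r| * C + ln K) / (t * (r - r')) <= m%:R by near: m; exact: nbhs_infty_ger.
rewrite ler_pdivrMr ?mulr_gt0 ?subr_gt0//.
have : - r * ((phi m)%:R - t * m%:R) <= `|r| * C.
  by apply: le_trans (ler_norm _) _; rewrite normrM normrN ler_wpM2l.
nra.
Unshelve. all: by end_near. Qed.

End LimSupInf.

(** * Comparison of correlation integrals *)

Section CorrelationIntegral.
Context {R : realType} {X : metricType R}.
Implicit Types (f : X -> X) (x y z : X) (m n : nat) (d e : R).

(** Changing the normalisation from [n ^ 2] to [N ^ 2] costs the factor [t ^ 2]. *)
Lemma corr_sum_le f g x m n d M N e s t : (0 < N)%N -> (N <= t * n)%N ->
  (corr_card g x m n d <= s * corr_card f x M N e)%N ->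
  corr_sum g x m n d <= (s * t ^ 2)%:R * corr_sum f x M N e.
Proof.
move=> N0 Ntn le_gf; rewrite /corr_sum -!/(corr_card _ _ _ _ _).
have n0 : (0 < n)%N by rewrite lt0n; apply: contraTneq Ntn => ->; rewrite muln0 -ltnNge.
rewrite [leRHS]mulrA ler_pdivrMr ?exprn_gt0 ?ltr0n// mulrAC.
rewrite ler_pdivlMr ?exprn_gt0 ?ltr0n// -!natrX -!natrM ler_nat.
have : (N ^ 2 <= (t * n) ^ 2)%N by rewrite leq_exp2r.
rewrite expnMn; set a := corr_card _ _ _ _ _ in le_gf *.
set b := corr_card _ _ _ _ _ in le_gf *; nia.
Qed.

Variables (f : X -> X) (x : X) (k : nat).
Hypothesis k_gt0 : (0 < k)%N.

Section Lower.
Variables (m M : nat) (d e : R).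
Hypotheses (d_ge0 : 0 <= d) (e_ge0 : 0 <= e).
Hypothesis bowen_le : forall y z, mdist y z <= d -> bowen_dist f k y z <= e.
Hypothesis le_Mmk : (M <= m * k)%N.

Lemma lcorr_iterl :
  (lcorr (iter k f) x m d <= ((2 * k) ^ 2)%:R%:E * lcorr f x M e)%E.
Proof.
(* Every length [N] of an [f]-orbit has to be served, hence the quotient; [N <= 2 * k * (N %/ k)]
   once [k <= N]. *)
rewrite /lcorr; apply: (limn_einf_le_comp _ (cvg_divnr _ k_gt0)).
  by rewrite ltr0n expn_gt0 muln_gt0 k_gt0.
near=> N; rewrite -EFinM lee_fin -[X in X%:R]mul1n.
have kN : (k <= N)%N by near: N; exact: nbhs_infty_ge.
apply: corr_sum_le; first exact: leq_trans kN.
  have := divn_eq N k; have := ltn_pmod N k_gt0.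
  have : (0 < N %/ k)%N by rewrite divn_gt0.
  nia.
by rewrite mul1n leq_corr_card_iterl ?leq_trunc_div.
Unshelve. all: by end_near. Qed.

Lemma ucorr_iterl :
  (ucorr (iter k f) x m d <= ((2 * k) ^ 2)%:R%:E * ucorr f x M e)%E.
Proof.
rewrite /ucorr; apply: (limn_esup_le_comp _ (cvg_mulnr _ k_gt0)).
  by rewrite ltr0n expn_gt0 muln_gt0 k_gt0.
near=> n; rewrite -EFinM lee_fin -[X in X%:R]mul1n.
have n0 : (0 < n)%N by near: n; exact: nbhs_infty_gt.
apply: corr_sum_le; [by rewrite muln_gt0 n0|nia|].
by rewrite mul1n leq_corr_card_iterl.
Unshelve. all: by end_near. Qed.

End Lower.

Section Upper.
Variables (m M : nat) (d e : R).
Hypotheses (d_ge0 : 0 <= d) (le_2de : d + d <= e).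
Hypothesis le_mkM : (m.+1 * k <= M)%N.

(** In the constant, [2 * k] comes from the colouring, [k] from the residues and [3 ^ 2] from the
    change of orbit length. *)
Lemma lcorr_iterr :
  (lcorr f x M d <= (2 * k * k * 3 ^ 2)%:R%:E * lcorr (iter k f) x m e)%E.
Proof.
rewrite /lcorr; apply: (limn_einf_le_comp (phi := fun n => ((n - 1) * k)%N)).
- by rewrite ltr0n !muln_gt0 k_gt0.
- exact: cvg_comp (cvg_subnr 1) (cvg_mulnr _ k_gt0).
near=> n; rewrite -EFinM lee_fin.
have n1 : (1 < n)%N by near: n; exact: nbhs_infty_gt.
apply: corr_sum_le; [exact: ltnW|nia|].
by rewrite -mulnA leq_corr_card_iterr// -{2}(mul1n k) -mulnDl subnK// ltnW.
Unshelve. all: by end_near. Qed.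

Lemma ucorr_iterr :
  (ucorr f x M d <= (2 * k * k * 3 ^ 2)%:R%:E * ucorr (iter k f) x m e)%E.
Proof.
(* One extra unit rounds [N] up to a multiple of [k], the other pays for the shift;
   [N %/ k + 2 <= 3 * N] explains the 3. *)
rewrite /ucorr; apply: (limn_esup_le_comp (phi := fun N => (N %/ k + 2)%N)).
- by rewrite ltr0n !muln_gt0 k_gt0.
- exact: cvg_comp (cvg_divnr _ k_gt0) (cvg_addnr 2).
near=> N; rewrite -EFinM lee_fin.
have N0 : (0 < N)%N by near: N; exact: nbhs_infty_gt.
apply: corr_sum_le; first by rewrite addn2.
  by have := leq_div N k; lia.
rewrite -mulnA leq_corr_card_iterr//.
by have := divn_eq N k; have := ltn_pmod N k_gt0; nia.
Unshelve. all: by end_near. Qed.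

End Upper.

End CorrelationIntegral.

(** * Uniform continuity of finitely many iterates *)

Section UniformContinuity.
Context {R : realType} {X : metricType R}.

Lemma near_bowen_dist_le (f : X -> X) (k : nat) (e : R) :
  compact [set: X] -> continuous f -> 0 < e ->
  \forall d \near 0^'+, forall y z, mdist y z <= d -> bowen_dist f k y z <= e.
Proof.
move=> cX cf e0.
have cfi i : continuous (iter i f).
  elim: i => [|i IH] z; first exact: cvg_id.
  exact: (continuous_comp (IH z) (cf _)).
suff unif (i : 'I_k) : \forall d \near (0 : R)^'+, forall y z,
    mdist y z <= d -> mdist (iter i f y) (iter i f z) <= e.
  near=> d => y z yz.
  have h : forall (i : 'I_k) y z,
      mdist y z <= d -> mdist (iter i f y) (iter i f z) <= e.
    by near: d; exact: filter_forall.
  by apply/bowen_dist_leP => [|j jk]; [exact: ltW|exact: (h (Ordinal jk))].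
(* Near-covering compactness turns a threshold for [d] valid around each point [y0] into a global
   one. *)
have /compact_near_coveringP := cX.
move=> /(_ _ (0 : R)^'+ (fun d y => forall z, mdist y z <= d ->
  mdist (iter i f y) (iter i f z) <= e)) near_cX.
suff /near_cX : forall y, [set: X] y -> \forall y' \near y & d \near (0 : R)^'+,
    forall z, mdist y' z <= d -> mdist (iter i f y') (iter i f z) <= e.
  by apply: filterS => d h y; exact: h.
move=> y0 _.
have e20 : 0 < e / 2 by rewrite divr_gt0.
have /= := cfi i y0 _ (nbhsx_ballx _ _ e20).
rewrite /= -nbhs_ballE => -[r /= r0]; rewrite !ballEmdist => fr.
have r20 : 0 < r / 2 by rewrite divr_gt0.
near=> y d => z /= yz.
have y0y : mdist y0 y < r / 2.
  suff : ball y0 (r / 2) y by rewrite ballEmdist.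
  by near: y; exact: nbhsx_ballx.
have d_lt : d < r / 2 by near: d; exact: nbhs_right_lt.
rewrite (le_trans (metric_triangle _ (iter i f y0) _))// (splitr e) lerD//.
  by rewrite metric_sym ltW//; apply: fr => /=; rewrite (lt_le_trans y0y)//; lra.
rewrite ltW//; apply: fr => /=.
by have := metric_triangle y0 y z; lra.
Unshelve. all: by end_near. Qed.

End UniformContinuity.

(** * Passage to small scales and comparison of entropies *)

(** The limit in [d] is taken first with [e] fixed, so the modulus of continuity linking the two
    scales disappears. *)
Lemma lim_at_right_leM (R : realType) (F G : R -> \bar R) (t : R) :
  cvg (F e @[e --> 0^'+]) -> cvg (G e @[e --> 0^'+]) ->
  (forall e, 0 < e -> \forall d \near 0^'+, (F e <= t%:E * G d)%E) ->
  (lim (F e @[e --> 0^'+]) <= t%:E * lim (G e @[e --> 0^'+]))%E.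
Proof.
move=> cF cG FG; apply: lime_le => //; near=> e; rewrite -limeMl//.
by apply: lime_ge; [exact: is_cvgeZl|exact: FG].
Unshelve. all: by end_near. Qed.

(** Supplies the bounded deviation from slope [1 / k] for index maps built from [%/ k]: divide
    [|p * k - m| <= c] by [k >= 1]. *)
Lemma dist_linear_inv (R : realType) (k p m c : nat) : (0 < k)%N ->
  (m <= p * k + c)%N -> (p * k <= m + c)%N ->
  `|p%:R - k%:R^-1 * m%:R| <= c%:R :> R.
Proof.
move=> k0; rewrite -!(ler_nat R) !natrD natrM => mp pm.
have k1 : 1 <= k%:R :> R by rewrite ler1n.
have k0R : 0 < k%:R :> R by rewrite ltr0n.
have c0 : 0 <= c%:R :> R by [].
rewrite -(ler_pM2l k0R) -{1}(gtr0_norm k0R) -normrM mulrBr mulrA.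
by rewrite divff ?gt_eqF// mul1r ler_norml; apply/andP; split; nra.
Qed.

Section IterateRates.
Context {R : realType} {X : metricType R}.
Variables (f : X -> X) (x : X) (k : nat).
Hypotheses (cX : compact [set: X]) (cf : continuous f) (k_gt0 : (0 < k)%N).

Let kR_gt0 : 0 < k%:R :> R. Proof. by rewrite ltr0n. Qed.
Let kV_gt0 : 0 < k%:R^-1 :> R. Proof. by rewrite invr_gt0. Qed.
Let K_gt0 : 0 < ((2 * k) ^ 2)%:R :> R.
Proof. by rewrite ltr0n expn_gt0 muln_gt0 k_gt0. Qed.
Let K'_gt0 : 0 < (2 * k * k * 3 ^ 2)%:R :> R.
Proof. by rewrite ltr0n !muln_gt0 k_gt0. Qed.

Lemma ucor_rate_iterl (e : R) : 0 < e -> \forall d \near 0^'+,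
  (ucor_rate f x e <= k%:R^-1%:E * ucor_rate (iter k f) x d)%E.
Proof.
move=> e0; have cfk := near_bowen_dist_le k cX cf e0.
near=> d; rewrite /ucor_rate.
(* Rounding up ensures that [m * k] covers all [M] steps. *)
apply: (@decay_rate_le_linear _ _ _ (fun M => (M %/ k).+1%N) _ k%:R _ _ K_gt0) => //.
  move=> M; apply: dist_linear_inv => //.
    by rewrite mulSn; have := divn_eq M k; have := ltn_pmod M k_gt0; lia.
  by rewrite mulSn; have := leq_trunc_div M k; lia.
apply: nearW => M; apply: lcorr_iterl => //; [exact: ltW| |].
  by near: d.
by rewrite mulSn; have := divn_eq M k; have := ltn_pmod M k_gt0; lia.
Unshelve. all: by end_near. Qed.

Lemma lcor_rate_iterl (e : R) : 0 < e -> \forall d \near 0^'+,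
  (lcor_rate f x e <= k%:R^-1%:E * lcor_rate (iter k f) x d)%E.
Proof.
move=> e0; have cfk := near_bowen_dist_le k cX cf e0.
near=> d; rewrite /lcor_rate lee_pdivlMl//.
apply: (@decay_rate_ge_linear _ _ _ (fun m => (m * k)%N) _ 0 _ _ K_gt0) => //.
  by move=> m; rewrite natrM mulrC subrr normr0.
apply: nearW => m; apply: ucorr_iterl => //; [exact: ltW|].
by near: d.
Unshelve. all: by end_near. Qed.

Lemma ucor_rate_iterr (e : R) : 0 < e -> \forall d \near 0^'+,
  (ucor_rate (iter k f) x e <= k%:R%:E * ucor_rate f x d)%E.
Proof.
move=> e0; have e20 : 0 < e / 2 by rewrite divr_gt0.
near=> d; have de : d <= e / 2 by near: d; exact: nbhs_right_le.
rewrite /ucor_rate.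
apply: (@decay_rate_le_linear _ _ _ (fun m => (m.+1 * k)%N) _ k%:R _ _ K'_gt0) => //.
  by move=> m; rewrite natrM mulrC -natr1 mulrDr mulr1 addrAC subrr add0r ger0_norm.
apply: nearW => m; apply: lcorr_iterr => //.
by rewrite (splitr e) lerD.
Unshelve. all: by end_near. Qed.

Lemma lcor_rate_iterr (e : R) : 0 < e -> \forall d \near 0^'+,
  (lcor_rate (iter k f) x e <= k%:R%:E * lcor_rate f x d)%E.
Proof.
move=> e0; have e20 : 0 < e / 2 by rewrite divr_gt0.
near=> d; have de : d <= e / 2 by near: d; exact: nbhs_right_le.
rewrite /lcor_rate -lee_pdivrMl//.
(* With [m = M %/ k - 1], [m.+1 * k <= M] holds once [k <= M]; rounding and the period lost to the
   shift together cost at most [2 * k]. *)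
apply: (@decay_rate_ge_linear _ _ _ (fun M => (M %/ k - 1)%N) _ (2 * k)%:R _ _ K'_gt0) => //.
  move=> M; apply: dist_linear_inv => //.
    by rewrite mulnBl mul1n; have := divn_eq M k; have := ltn_pmod M k_gt0; lia.
  by rewrite mulnBl; have := leq_trunc_div M k; lia.
near=> M; have kM : (k <= M)%N by near: M; exact: nbhs_infty_ge.
apply: ucorr_iterr => //.
  by rewrite (splitr e) lerD.
by rewrite subn1 prednK ?divn_gt0// leq_trunc_div.
Unshelve. all: by end_near. Qed.

End IterateRates.

Theorem theoremA (R : realType) (X : metricType R) (f : X -> X)
    (cX : compact [set: X]) (cf : continuous f)
    (k : nat) (k_gt0 : (0 < k)%N) (x : X) :
  (ucor_entropy (iter k f) x = k%:R%:E * ucor_entropy f x)%E /\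
  (lcor_entropy (iter k f) x = k%:R%:E * lcor_entropy f x)%E.
Proof.
have k0 : 0 < k%:R :> R by rewrite ltr0n.
split; apply/eqP; rewrite eq_le; apply/andP; split.
(* The colouring bounds give [<=], and the uniform continuity bounds, after division by [k], give
   [>=]. *)
- apply: lim_at_right_leM => [||e e0]; [exact: is_cvg_ucor_rate..|].
  exact: ucor_rate_iterr.
- rewrite -lee_pdivlMl//; apply: lim_at_right_leM => [||e e0]; [exact: is_cvg_ucor_rate..|].
  exact: ucor_rate_iterl.
- apply: lim_at_right_leM => [||e e0]; [exact: is_cvg_lcor_rate..|].
  exact: lcor_rate_iterr.
- rewrite -lee_pdivlMl//; apply: lim_at_right_leM => [||e e0]; [exact: is_cvg_lcor_rate..|].
  exact: lcor_rate_iterl.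
Qed.
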